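(* If a free boundary $s_4$ and a temperature $T_4$ constitute a solution to problem $(\mathrm{P}_4)$, then they are given by $$T_4(x,t)=t^{\alpha/2}\theta_\infty\left[A_4\left(1-\frac{x}{s_4(t)}\right)+B_4\left(1-\frac{x}{s_4(t)}\right)^2\right],\qquad s_4(t)=2a\nu_4\sqrt{t},$$ where the constants $A_4$ and $B_4$ are defined as functions of $\nu_4$ by $$A_4=\frac{2^{\alpha+1}\nu_4^{\alpha+2}}{\mathrm{Ste}},\qquad B_4=1-\frac{2^{\alpha+1}\nu_4^{\alpha+2}}{\mathrm{Ste}},$$ and where $\nu_4>0$ must minimize over $\xi>0$, for every $t>0$, the function $$E(\xi)=\frac{t^{\alpha-2}\theta_\infty^2}{60\,\mathrm{Ste}^2}\,\frac{p(\xi)}{\xi^4}$$ with $$\begin{aligned}p(\xi)=\;&2^{2\alpha+1}(\alpha^2+\alpha+4)\xi^{2\alpha+8}+5\cdot 2^{2\alpha+2}(1+\alpha)\xi^{2\alpha+6}+15\cdot 2^{2\alpha+2}\xi^{2\alpha+4}\\&+2^{\alpha}\mathrm{Ste}(2+3\alpha+3\alpha^2)\xi^{\alpha+6}+5\cdot 2^{\alpha+1}\mathrm{Ste}(1+\alpha)\xi^{\alpha+4}-15\cdot 2^{\alpha+2}\mathrm{Ste}\,\xi^{\alpha+2}\\&+\mathrm{Ste}^2(2+3\alpha+3\alpha^2)\xi^4-10\,\mathrm{Ste}^2(1+\alpha)\xi^2+15\,\mathrm{Ste}^2.\end{aligned}$$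
   Context: Fix real parameters $k,\rho,c,\gamma,\theta_\infty>0$ and $\alpha\ge 0$; put $a=\sqrt{k/(\rho c)}$ and define the generalized Stefan number $\mathrm{Ste}=\dfrac{k\theta_\infty}{\gamma a^{\alpha+2}}$. A candidate pair $(T,s)$ consists of a continuous function $s:[0,\infty)\to[0,\infty)$, positive and continuously differentiable on $(0,\infty)$, and a function with quadratic profile in space $$T(x,t)=t^{\alpha/2}\theta_\infty\left[A\left(1-\frac{x}{s(t)}\right)+B\left(1-\frac{x}{s(t)}\right)^2\right],\quad 0\le x\le s(t),\ t>0,$$ with real constants $A,B$. The least-squares error of a candidate pair at time $t>0$ is $$\begin{aligned}E=\;&\tfrac{\alpha^2}{4}\theta_\infty^2t^{\alpha-2}\left(\tfrac{A^2}{3}+\tfrac{AB}{2}+\tfrac{B^2}{5}\right)+t^{\alpha}\theta_\infty^2\tfrac{\dot s(t)^2}{s(t)^2}\left(\tfrac{A^2}{3}+\tfrac{AB}{3}+\tfrac{2B^2}{15}\right)+4t^{\alpha}a^4\theta_\infty^2\tfrac{B^2}{s(t)^4}\\&+\alpha\theta_\infty^2t^{\alpha-1}\tfrac{\dot s(t)}{s(t)}\left(\tfrac{A^2}{6}+\tfrac{AB}{4}+\tfrac{B^2}{10}\right)-2\alpha a^2\theta_\infty^2t^{\alpha-1}\tfrac{B}{s(t)^2}\left(\tfrac A2+\tfrac B3\right)-4a^2\theta_\infty^2t^{\alpha}\tfrac{\dot s(t)}{s(t)^3}B\left(\tfrac A2+\tfrac B3\right),\end{aligned}$$ which equals $\dfrac{1}{s(t)}\displaystyle\int_0^{s(t)}\left(\frac{\partial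 T}{\partial t}-a^2\frac{\partial^2T}{\partial x^2}\right)^2dx$. Problem $(\mathrm{P}_4)$: among all candidate pairs satisfying, for all $t>0$, (i) $T(0,t)=\theta_\infty t^{\alpha/2}$, (ii) $T(s(t),t)=0$, (iii) $k\frac{\partial T}{\partial x}(s(t),t)=-\gamma s(t)^{\alpha}\dot s(t)$, and (iv) $s(0)=0$, find a pair $(T_4,s_4)$ that minimizes the error $E$ for every $t>0$. *)

(* Defs.v *)
From Stdlib Require Import Reals Lra.
From Coquelicot Require Import Coquelicot.

Open Scope R_scope.

Definition diffusion_coef (k rho c : R) : R := sqrt (k / (rho * c)).

Definition stefan_number (k gamma theta alpha a : R) : R :=
  k * theta / (gamma * Rpower a (alpha + 2)).

Definition profile (theta alpha A B : R) (s : R -> R) (x t : R) : R :=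
  Rpower t (alpha / 2) * theta *
    (A * (1 - x / s t) + B * (1 - x / s t) ^ 2).

(* Functions on [0,oo), resp. on {(x,t) | t > 0, 0 <= x <= s t}, are
   represented by total functions whose values elsewhere are irrelevant. *)
Definition is_free_boundary (s : R -> R) : Prop :=
  (forall t, 0 <= t -> 0 <= s t) /\
  continuous_on (fun t => 0 <= t) s /\
  (forall t, 0 < t -> 0 < s t /\ ex_derive s t /\ continuous (Derive s) t).

Definition is_candidate (theta alpha : R) (T : R -> R -> R) (s : R -> R)
    (A B : R) : Prop :=
  is_free_boundary s /\
  (forall x t, 0 < t -> 0 <= x <= s t -> T x t = profile theta alpha A B s x t).

(* One-sided, because T is only meaningful for x <= s t. *)
Definition is_left_derive (f : R -> R) (x l : R) : Prop :=
  filterlim (fun y => (f y - f x) / (y - x)) (at_left x) (locally l).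

Definition ls_error (theta alpha a A B : R) (s : R -> R) (t : R) : R :=
  alpha ^ 2 / 4 * theta ^ 2 * Rpower t (alpha - 2)
    * (A ^ 2 / 3 + A * B / 2 + B ^ 2 / 5)
  + Rpower t alpha * theta ^ 2 * ((Derive s t) ^ 2 / (s t) ^ 2)
    * (A ^ 2 / 3 + A * B / 3 + 2 * B ^ 2 / 15)
  + 4 * Rpower t alpha * a ^ 4 * theta ^ 2 * (B ^ 2 / (s t) ^ 4)
  + alpha * theta ^ 2 * Rpower t (alpha - 1) * (Derive s t / s t)
    * (A ^ 2 / 6 + A * B / 4 + B ^ 2 / 10)
  - 2 * alpha * a ^ 2 * theta ^ 2 * Rpower t (alpha - 1) * (B / (s t) ^ 2)
    * (A / 2 + B / 3)
  - 4 * a ^ 2 * theta ^ 2 * Rpower t alpha * (Derive s t / (s t) ^ 3) * B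
    * (A / 2 + B / 3).

Definition P4_admissible (k gamma theta alpha : R) (T : R -> R -> R)
    (s : R -> R) (A B : R) : Prop :=
  is_candidate theta alpha T s A B /\
  (forall t, 0 < t ->
     T 0 t = theta * Rpower t (alpha / 2) /\
     T (s t) t = 0 /\
     (exists Tx, is_left_derive (fun x => T x t) (s t) Tx /\
        k * Tx = - gamma * Rpower (s t) alpha * Derive s t)) /\
  s 0 = 0.

Definition P4_solution (k rho c gamma theta alpha : R) (T : R -> R -> R)
    (s : R -> R) : Prop :=
  let a := diffusion_coef k rho c in
  exists A B : R,
    P4_admissible k gamma theta alpha T s A B /\
    (forall (T' : R -> R -> R) (s' : R -> R) (A' B' : R),
       P4_admissible k gamma theta alpha T' s' A' B' ->
       forall t, 0 < t ->
         ls_error theta alpha a A B s t <= ls_error theta alpha a A' B' s' t).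

Definition p_fun (Ste alpha xi : R) : R :=
  Rpower 2 (2 * alpha + 1) * (alpha ^ 2 + alpha + 4)
    * Rpower xi (2 * alpha + 8)
  + 5 * Rpower 2 (2 * alpha + 2) * (1 + alpha) * Rpower xi (2 * alpha + 6)
  + 15 * Rpower 2 (2 * alpha + 2) * Rpower xi (2 * alpha + 4)
  + Rpower 2 alpha * Ste * (2 + 3 * alpha + 3 * alpha ^ 2)
    * Rpower xi (alpha + 6)
  + 5 * Rpower 2 (alpha + 1) * Ste * (1 + alpha) * Rpower xi (alpha + 4)
  - 15 * Rpower 2 (alpha + 2) * Ste * Rpower xi (alpha + 2)
  + Ste ^ 2 * (2 + 3 * alpha + 3 * alpha ^ 2) * xi ^ 4
  - 10 * Ste ^ 2 * (1 + alpha) * xi ^ 2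
  + 15 * Ste ^ 2.

Definition reduced_error (Ste theta alpha t xi : R) : R :=
  Rpower t (alpha - 2) * theta ^ 2 / (60 * Ste ^ 2)
    * (p_fun Ste alpha xi / xi ^ 4).

Lemma is_derive_profile_t (theta alpha A B : R) (s : R -> R) (x t : R) :
  0 < t -> 0 < s t -> ex_derive s t ->
  is_derive (fun u => profile theta alpha A B s x u) t
    (Rpower t (alpha / 2) * theta *
      (alpha / 2 / t * (A * (1 - x / s t) + B * (1 - x / s t) ^ 2)
       + Derive s t / s t * (x / s t) * (A + 2 * B * (1 - x / s t)))).
Proof.
  intros ht hs hd. unfold profile, Rpower.
  auto_derive.
  - repeat split; try lra; assumption.
  - replace (Derive (fun u : R => s u) t) with (Derive s t) by reflexivity.
    field; lra.
Qed.

Lemma Derive2_profile_x (theta alpha A B : R) (s : R -> R) (x t : R) :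
  0 < s t ->
  Derive_n (fun y => profile theta alpha A B s y t) 2 x
  = Rpower t (alpha / 2) * theta * (2 * B / (s t) ^ 2).
Proof.
  intros hs. simpl.
  rewrite (Derive_ext _ (fun y => Rpower t (alpha / 2) * theta *
     (- A / s t - 2 * B * (1 - y / s t) / s t))).
  - apply is_derive_unique. auto_derive; [exact I|]. field; lra.
  - intros y. apply is_derive_unique. unfold profile.
    auto_derive; [exact I|]. field; lra.
Qed.

Lemma ls_error_integral (theta alpha a A B : R) (T : R -> R -> R)
    (s : R -> R) (t : R) :
  is_candidate theta alpha T s A B -> 0 < t ->
  ls_error theta alpha a A B s t
  = / s t * RInt (fun x => (Derive (fun u => T x u) t
                    - a ^ 2 * Derive_n (fun y => T y t) 2 x) ^ 2) 0 (s t).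
Proof.
  intros [[_ [_ hs]] hT] ht.
  destruct (hs t ht) as [st [ds _]].
  set (K := Rpower t (alpha / 2) * theta).
  set (c1 := alpha / 2 / t).
  set (q := Derive s t / s t).
  set (d0 := q * A - a ^ 2 * (2 * B / (s t) ^ 2)).
  set (d1 := c1 * A + q * (2 * B - A)).
  set (d2 := c1 * B - 2 * q * B).
  pose (f := fun x => (K * (d0 + d1 * (1 - x / s t)
                            + d2 * (1 - x / s t) ^ 2)) ^ 2).
  pose (F := fun x => - s t * K ^ 2 *
     (d0 ^ 2 * (1 - x / s t) + d0 * d1 * (1 - x / s t) ^ 2
      + (d1 ^ 2 + 2 * d0 * d2) / 3 * (1 - x / s t) ^ 3
      + d1 * d2 / 2 * (1 - x / s t) ^ 4 + d2 ^ 2 / 5 * (1 - x / s t) ^ 5)).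
  assert (hI : is_RInt f 0 (s t) (minus (F (s t)) (F 0))).
  { apply (is_RInt_derive F f).
    - intros x _. unfold F, f. auto_derive; [exact I|]. field; lra.
    - intros x _. apply (ex_derive_continuous f). unfold f.
      auto_derive. exact I. }
  rewrite (RInt_ext _ f).
  - rewrite (is_RInt_unique _ _ _ _ hI).
    assert (e0 : Rpower t alpha = Rpower t (alpha / 2) ^ 2).
    { simpl. rewrite Rmult_1_r, <- Rpower_plus. f_equal. lra. }
    assert (e1 : Rpower t (alpha - 1) = Rpower t (alpha / 2) ^ 2 / t).
    { unfold Rminus. rewrite Rpower_plus, e0, Rpower_Ropp, Rpower_1 by lra.
      reflexivity. }
    assert (e2 : Rpower t (alpha - 2) = Rpower t (alpha / 2) ^ 2 / t ^ 2).
    { replace (alpha - 2) with (alpha - 1 + - (1)) by lra.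
      rewrite Rpower_plus, e1, Rpower_Ropp, Rpower_1 by lra. field; lra. }
    unfold ls_error. rewrite e0, e1, e2.
    unfold minus, plus, opp; simpl.
    unfold F, d0, d1, d2, K, c1, q. field; lra.
  - rewrite Rmin_left, Rmax_right by lra. intros x hx.
    match goal with |- ?l = ?r => change (@eq R l r) end.
    assert (cont : locally t (fun u => x < s u)).
    { apply (ex_derive_continuous s t ds (fun y => x < y)).
      apply open_gt. lra. }
    rewrite (Derive_ext_loc _ (fun u => profile theta alpha A B s x u)).
    2:{ generalize (filter_and _ _ cont (open_gt 0 t ht)).
        apply filter_imp. intros u [h1 h2]. apply hT; lra. }
    etransitivity.
    { apply (f_equal (fun d => (d - _) ^ 2)), is_derive_unique.
      apply is_derive_profile_t; assumption. }
    rewrite (Derive_n_ext_loc _ (fun y => profile theta alpha A B s y t)).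
    2:{ generalize (filter_and _ _ (open_gt 0 x (proj1 hx))
                      (open_lt (s t) x (proj2 hx))).
        apply filter_imp. intros y [h1 h2]. apply hT; lra. }
    rewrite Derive2_profile_x by lra.
    unfold f, d0, d1, d2, K, c1, q. field; lra.
Qed.

(* Main.v *)
Require Import Defs.
From Stdlib Require Import Reals Lra.
From Coquelicot Require Import Coquelicot.
Open Scope R_scope.

(** Condition (i) forces [A + B = 1], and the Stefan condition (iii) reads
    [s^(alpha+1) s' = (k theta A / gamma) t^(alpha/2)], i.e. the function
    [s^(alpha+2) - (2 k theta A / gamma) t^(alpha/2+1)] is constant; as
    [s 0 = 0], the constant is zero.  Hence the admissible pairs are exactly
    the self-similar ones [s = 2 a nu sqrt t], one for each [nu > 0], with [A]
    determined by [nu].  On this one-parameter family the least-squares error is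
    the reduced error at [nu], so minimality over admissible pairs is minimality
    over [nu]. *)

(** * Real powers *)

Lemma Rpower_inj_base (x y p : R) :
  0 < x -> 0 < y -> p <> 0 -> Rpower x p = Rpower y p -> x = y.
Proof.
  intros hx hy hp e.
  rewrite <- (Rpower_1 x), <- (Rpower_1 y), <- (Rinv_r p) by assumption.
  rewrite <- !Rpower_mult, e. reflexivity.
Qed.

(** Controls powers as the base tends to 0. Since [ln 0 = 0] by convention, [Rpower 0 p] is 1, so
    the limit cannot be read off by evaluating at 0. *)
Lemma Rpower_le_base (x p : R) : 0 < x <= 1 -> 1 <= p -> Rpower x p <= x.
Proof.
  intros hx hp. rewrite <- (Rpower_1 x) at 2 by lra.
  assert (h : ln x <= 0) by (rewrite <- ln_1; apply ln_le; lra).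
  unfold Rpower. destruct (Req_dec (p * ln x) (1 * ln x)) as [-> | ne]; [lra|].
  left. apply exp_increasing. nra.
Qed.

Lemma Rpower_half (t alpha : R) :
  0 < t -> Rpower t (alpha / 2) = Rpower (sqrt t) alpha.
Proof.
  intros ht. rewrite <- Rpower_sqrt, Rpower_mult by assumption.
  f_equal; lra.
Qed.

Lemma Rpower_plus_2 (x p : R) : 0 < x -> Rpower x (p + 2) = Rpower x p * x ^ 2.
Proof.
  intros hx. rewrite Rpower_plus. f_equal.
  replace 2 with (INR 2) at 1 by (simpl; lra). apply Rpower_pow; assumption.
Qed.

Lemma Rpower_plus_1 (x p : R) : 0 < x -> Rpower x (p + 1) = Rpower x p * x.
Proof. intros hx. rewrite Rpower_plus, Rpower_1 by assumption. reflexivity. Qed.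

Lemma is_derive_Rpower (s : R -> R) (p t d : R) :
  0 < s t -> is_derive s t d ->
  is_derive (fun u => Rpower (s u) p) t (p * Rpower (s t) (p - 1) * d).
Proof.
  intros hs hd. unfold Rminus. rewrite Rpower_plus, Rpower_Ropp, Rpower_1 by assumption.
  unfold Rpower. auto_derive.
  - repeat split; [eexists; exact hd | exact hs].
  - replace (Derive (fun u : R => s u) t) with d
      by (symmetry; apply is_derive_unique, hd).
    field. lra.
Qed.

(** * Vanishing derivatives and one-sided derivatives *)

Lemma derive_zero_constant_pos (g : R -> R) :
  (forall t, 0 < t -> is_derive g t 0) ->
  forall t u, 0 < t -> 0 < u -> g t = g u.
Proof.
  intros hg t u ht hu.
  destruct (MVT_gen g t u (fun _ => 0)) as [c [_ e]].
  - intros x hx. apply hg.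
    generalize (Rmin_pos t u ht hu); lra.
  - intros x hx. apply continuity_pt_filterlim, (ex_derive_continuous g).
    exists 0. apply hg. generalize (Rmin_pos t u ht hu); lra.
  - lra.
Qed.

Lemma is_left_derive_unique (f : R -> R) (x l l' : R) :
  is_left_derive f x l -> is_left_derive f x l' -> l = l'.
Proof. intros h h'. exact (filterlim_locally_unique _ _ _ h h'). Qed.

(** Lets the profile stand in for [T], which agrees with it only up to the front. The value at [x]
    is a separate hypothesis because [at_left x] excludes [x]. *)
Lemma is_derive_is_left_derive (f g : R -> R) (x l : R) :
  f x = g x -> at_left x (fun y => f y = g y) ->
  is_derive g x l -> is_left_derive f x l.
Proof.
  intros ex eloc hd.
  apply filterlim_ext_loc with (fun y => (g y - g x) / (y - x)).
  { revert eloc. apply filter_imp. intros y ey. rewrite ex, ey. reflexivity. }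
  apply is_derive_Reals in hd.
  intros P [eps hP].
  destruct (hd eps (cond_pos eps)) as [delta hdelta].
  exists delta. intros y hy hlt.
  apply hP. change (Rabs ((g y - g x) / (y - x) - l) < eps).
  replace (g y) with (g (x + (y - x))) by (f_equal; lra).
  apply hdelta; [lra | exact hy].
Qed.

(** The [B] term has a double zero at the front, so only [A] contributes to the flux. *)
Lemma is_derive_profile_front (theta alpha A B : R) (s : R -> R) (t : R) :
  0 < s t ->
  is_derive (fun x => profile theta alpha A B s x t) (s t)
    (- (Rpower t (alpha / 2) * theta * A / s t)).
Proof.
  intros hs. unfold profile. auto_derive; [exact I|]. field; lra.
Qed.

Lemma candidate_left_derive (theta alpha A B : R) (T : R -> R -> R) (s : R -> R)
    (t : R) :
  is_candidate theta alpha T s A B -> 0 < t ->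
  is_left_derive (fun x => T x t) (s t) (- (Rpower t (alpha / 2) * theta * A / s t)).
Proof.
  intros [[_ [_ hs]] hT] ht. destruct (hs t ht) as [hst _].
  apply is_derive_is_left_derive with (fun x => profile theta alpha A B s x t).
  - apply hT; lra.
  - unfold at_left, within.
    generalize (open_gt 0 (s t) hst). apply filter_imp.
    intros y hy hlt. apply hT; lra.
  - apply is_derive_profile_front; assumption.
Qed.

(** * Integration of the Stefan condition *)

(** The two sides have equal derivatives because [2 * c * (alpha / 2 + 1) = c * (alpha + 2)]. Their
    difference [g] is constant on positive times only, and its value is found by letting [t] tend to
    0. *)
Lemma power_law_of_ode (s : R -> R) (alpha c : R) :
  0 <= alpha -> is_free_boundary s -> s 0 = 0 ->
  (forall t, 0 < t -> Rpower (s t) alpha * s t * Derive s t = c * Rpower t (alpha / 2)) ->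
  forall t, 0 < t -> Rpower (s t) (alpha + 2) = 2 * c * Rpower t (alpha / 2 + 1).
Proof.
  intros halpha [_ [hcont hs]] h0 hode.
  pose (g := fun t => Rpower (s t) (alpha + 2) - 2 * c * Rpower t (alpha / 2 + 1)).
  assert (hg : forall t u, 0 < t -> 0 < u -> g t = g u).
  { apply derive_zero_constant_pos. intros t ht.
    destruct (hs t ht) as [hst [hd _]].
    evar_last.
    - unfold g. apply (is_derive_minus (fun t => Rpower (s t) (alpha + 2))
        (fun t => 2 * c * Rpower t (alpha / 2 + 1))).
      + apply is_derive_Rpower; [exact hst | apply Derive_correct; exact hd].
      + apply is_derive_scal, (is_derive_Rpower (fun u => u)); [exact ht |].
        apply (is_derive_id (K := R_AbsRing)).
    - unfold minus, plus, opp, one; simpl.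
      replace (alpha + 2 - 1) with (alpha + 1) by lra.
      replace (alpha / 2 + 1 - 1) with (alpha / 2) by lra.
      rewrite Rpower_plus_1 by exact hst.
      generalize (hode t ht). intros e.
      replace ((alpha + 2) * (Rpower (s t) alpha * s t) * Derive s t)
        with ((alpha + 2) * (Rpower (s t) alpha * s t * Derive s t)) by ring.
      rewrite e. field. }
  (* At a small time both powers in [g] are at most their bases, and [s t] and [t] are both at most
     [eps]. *)
  assert (hsmall : forall eps, 0 < eps <= 1 ->
            Rabs (g 1) <= eps * (1 + Rabs (2 * c))).
  { intros eps he.
    assert (hl : locally (s 0) (fun y => y < eps))
      by (rewrite h0; apply (open_lt eps); lra).
    destruct (hcont 0 (Rle_refl 0) _ hl) as [d hdlt].
    (* [d / 2] keeps [t] within the continuity radius [d]; [eps] bounds [t] itself. *)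
    pose (t := Rmin (d / 2) eps).
    assert (hd := cond_pos d).
    assert (ht : 0 < t) by (apply Rmin_pos; lra).
    assert (htd : t <= d / 2) by apply Rmin_l.
    assert (hte : t <= eps) by apply Rmin_r.
    assert (hst : s t < eps).
    { apply hdlt; [|lra]. change (Rabs (t - 0) < d). rewrite Rabs_pos_eq; lra. }
    destruct (hs t ht) as [hpos _].
    rewrite (hg 1 t) by lra. unfold g.
    assert (h1 : Rpower (s t) (alpha + 2) <= s t) by (apply Rpower_le_base; lra).
    assert (h2 : Rpower t (alpha / 2 + 1) <= t) by (apply Rpower_le_base; lra).
    assert (p1 : 0 < Rpower (s t) (alpha + 2)) by apply exp_pos.
    assert (p2 : 0 < Rpower t (alpha / 2 + 1)) by apply exp_pos.
    eapply Rle_trans; [apply Rabs_triang|].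
    rewrite Rabs_Ropp, Rabs_mult, !(Rabs_pos_eq (Rpower _ _)) by lra.
    generalize (Rabs_pos (2 * c)). nra. }
  assert (hz : g 1 = 0).
  { destruct (Req_dec (g 1) 0) as [e | ne]; [exact e | exfalso].
    assert (hp := Rabs_pos_lt _ ne).
    assert (hc := Rabs_pos (2 * c)).
    set (m := Rabs (g 1)) in *. set (b := 1 + Rabs (2 * c)) in *.
    assert (hb : 0 < b) by (unfold b; lra).
    (* With this [eps] the bound [m <= eps * b] gives [m <= m / 2], contradicting [0 < m]. *)
    pose (eps := Rmin 1 (m / (2 * b))).
    assert (hq : 0 < m / (2 * b)) by (apply Rdiv_lt_0_compat; lra).
    assert (he : 0 < eps) by (apply Rmin_pos; lra).
    assert (he1 : eps <= 1) by apply Rmin_l.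
    assert (he2 : eps <= m / (2 * b)) by apply Rmin_r.
    assert (h := hsmall eps (conj he he1)).
    assert (h' : eps * b <= m / (2 * b) * b) by (apply Rmult_le_compat_r; lra).
    replace (m / (2 * b) * b) with (m / 2) in h' by (field; lra).
    lra. }
  intros t ht. assert (e := hg t 1 ht Rlt_0_1). rewrite hz in e. unfold g in e. lra.
Qed.

(** * Admissible pairs are self-similar *)

Lemma diffusion_coef_pos (k rho c : R) :
  0 < k -> 0 < rho -> 0 < c -> 0 < diffusion_coef k rho c.
Proof.
  intros hk hrho hc. apply sqrt_lt_R0, Rdiv_lt_0_compat;
  [|apply Rmult_lt_0_compat]; assumption.
Qed.

Lemma stefan_number_pos (k gamma theta alpha a : R) :
  0 < k -> 0 < gamma -> 0 < theta -> 0 < stefan_number k gamma theta alpha a.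
Proof.
  intros hk hg ht. apply Rdiv_lt_0_compat; apply Rmult_lt_0_compat; try assumption.
  apply exp_pos.
Qed.

Lemma admissible_self_similar (k gamma theta alpha a : R) (T : R -> R -> R)
    (s : R -> R) (A B : R) :
  0 < k -> 0 < gamma -> 0 < theta -> 0 <= alpha -> 0 < a ->
  P4_admissible k gamma theta alpha T s A B ->
  exists nu, 0 < nu /\
    A = Rpower 2 (alpha + 1) * Rpower nu (alpha + 2)
          / stefan_number k gamma theta alpha a /\
    B = 1 - A /\
    (forall t, 0 <= t -> s t = 2 * a * nu * sqrt t).
Proof.
  intros hk hg hth hal ha [hcand [hbc h0]].
  pose proof hcand as [hfb hT]. pose proof hfb as [hnn [_ hs]].
  assert (hAB : B = 1 - A).
  { destruct (hbc 1 Rlt_0_1) as [e _].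
    rewrite hT in e; [|lra | generalize (hnn 1); lra].
    unfold profile in e. destruct (hs 1 Rlt_0_1) as [hs1 _].
    assert (hp : 0 < Rpower 1 (alpha / 2) * theta)
      by (apply Rmult_lt_0_compat; [apply exp_pos | exact hth]).
    replace (A * (1 - 0 / s 1) + B * (1 - 0 / s 1) ^ 2) with (A + B) in e
      by (field; lra).
    apply (Rmult_eq_reg_l (Rpower 1 (alpha / 2) * theta)); lra. }
  assert (hpow : forall t, 0 < t ->
            Rpower (s t) (alpha + 2)
            = 2 * (k * theta * A / gamma) * Rpower t (alpha / 2 + 1)).
  { apply power_law_of_ode; try assumption.
    intros t ht. destruct (hs t ht) as [hst _].
    destruct (hbc t ht) as [_ [_ [Tx [hTx e]]]].
    (* The flux in the Stefan condition must be the left derivative of the profile. *)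
    rewrite (is_left_derive_unique _ _ _ _ hTx
      (candidate_left_derive _ _ _ _ _ _ _ hcand ht)) in e.
    replace (Rpower (s t) alpha * s t * Derive s t)
      with (- (- gamma * Rpower (s t) alpha * Derive s t) * s t / gamma)
      by (field; lra).
    rewrite <- e. field; lra. }
  destruct (hs 1 Rlt_0_1) as [hs1 _].
  assert (h1 := hpow 1 Rlt_0_1).
  assert (er : Rpower 1 (alpha / 2 + 1) = 1)
    by (unfold Rpower; rewrite ln_1, Rmult_0_r; apply exp_0).
  rewrite er, Rmult_1_r in h1.
  (* Read off from [s 1 = 2 * a * nu * sqrt 1]. *)
  exists (s 1 / (2 * a)).
  assert (hnu : 0 < s 1 / (2 * a)) by (apply Rdiv_lt_0_compat; lra).
  repeat split; try assumption.
  (* Expanding [s 1 = 2 * a * nu] inside the power law at time 1 gives a linear equation for [A]. *)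
  - assert (e : Rpower (s 1) (alpha + 2)
       = Rpower 2 (alpha + 1) * 2 * Rpower a (alpha + 2)
         * Rpower (s 1 / (2 * a)) (alpha + 2)).
    { rewrite <- Rpower_plus_1 by lra.
      replace (alpha + 1 + 1) with (alpha + 2) by lra.
      rewrite !Rpower_mult_distr by nra. f_equal. field; lra. }
    rewrite h1 in e. unfold stefan_number.
    replace (Rpower 2 (alpha + 1) * Rpower (s 1 / (2 * a)) (alpha + 2) /
      (k * theta / (gamma * Rpower a (alpha + 2))))
      with (gamma / (2 * k * theta) * (Rpower 2 (alpha + 1) * 2 * Rpower a (alpha + 2)
         * Rpower (s 1 / (2 * a)) (alpha + 2))).
    + rewrite <- e. field; lra.
    + field. repeat split; try lra. apply Rgt_not_eq, exp_pos.
  - intros t [ht | <-].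
    2: { rewrite sqrt_0, h0. ring. }
    assert (hq := sqrt_lt_R0 t ht). destruct (hs t ht) as [hst _].
    replace (2 * a * (s 1 / (2 * a)) * sqrt t) with (s 1 * sqrt t) by (field; lra).
    (* By the power law at [t] and at 1, both sides have the same power of exponent [alpha + 2]. *)
    apply Rpower_inj_base with (alpha + 2); [exact hst | nra | lra |].
    rewrite hpow, <- h1, <- Rpower_mult_distr by assumption. f_equal.
    rewrite <- Rpower_half by exact ht. f_equal. field.
Qed.

(** * Every self-similar pair is admissible *)

Lemma is_derive_self_similar (b t : R) :
  0 < t -> is_derive (fun u => b * sqrt u) t (b / (2 * sqrt t)).
Proof.
  intros ht. auto_derive; [exact ht|]. field. apply Rgt_not_eq, sqrt_lt_R0, ht.
Qed.

Lemma self_similar_free_boundary (b : R) :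
  0 < b -> is_free_boundary (fun t => b * sqrt t).
Proof.
  intros hb. split; [|split].
  - intros t _. apply Rmult_le_pos; [lra | apply sqrt_pos].
  - apply continuous_on_forall. intros t _.
    apply (continuous_scal_r b (fun u => sqrt u)), continuous_sqrt.
  - intros t ht. assert (hq := sqrt_lt_R0 t ht). split; [nra | split].
    + eexists. apply is_derive_self_similar, ht.
    + apply continuous_ext_loc with (fun u => b / (2 * sqrt u)).
      * generalize (open_gt 0 t ht). apply filter_imp. intros u hu.
        symmetry. apply is_derive_unique, is_derive_self_similar, hu.
      * apply (ex_derive_continuous (fun u => b / (2 * sqrt u))).
        auto_derive. repeat split; lra.
Qed.

(** Supplies a competitor for each [nu]. Both sides of the Stefan condition scale as [t] to the
    power [(alpha - 1) / 2], and this [A] matches their coefficients. *)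
Lemma self_similar_admissible (k gamma theta alpha a nu : R) :
  0 < k -> 0 < gamma -> 0 < theta -> 0 < a -> 0 < nu ->
  let A := Rpower 2 (alpha + 1) * Rpower nu (alpha + 2)
             / stefan_number k gamma theta alpha a in
  let s := fun t => 2 * a * nu * sqrt t in
  P4_admissible k gamma theta alpha (profile theta alpha A (1 - A) s) s A (1 - A).
Proof.
  intros hk hg hth ha hnu A s.
  assert (hb : 0 < 2 * a * nu) by (repeat apply Rmult_lt_0_compat; lra).
  assert (hcand : is_candidate theta alpha (profile theta alpha A (1 - A) s) s A (1 - A)).
  { split; [apply self_similar_free_boundary, hb | reflexivity]. }
  split; [exact hcand | split].
  - intros t ht. assert (hq := sqrt_lt_R0 t ht).
    assert (hst : 0 < s t) by (apply Rmult_lt_0_compat; assumption).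
    repeat split.
    + unfold profile. field. lra.
    + unfold profile. field. lra.
    + eexists. split; [apply (candidate_left_derive _ _ _ _ _ _ _ hcand ht)|].
      replace (Derive s t) with (2 * a * nu / (2 * sqrt t))
        by (symmetry; apply is_derive_unique, is_derive_self_similar, ht).
      unfold A, s, stefan_number.
      rewrite <- !Rpower_mult_distr, Rpower_half, Rpower_plus_1, !Rpower_plus_2
        by (assumption || nra).
      assert (pa : 0 < Rpower a alpha) by apply exp_pos.
      field. repeat split; nra.
  - unfold s. rewrite sqrt_0. ring.
Qed.

(** * The error on the self-similar family *)

(** Each non-integer power of [xi] in [p_fun] comes with the power of 2 that makes it a multiple of
    [A] or [A ^ 2]. What remains is polynomial in [A] and [xi], the form [ls_error] takes once
    [B = 1 - A]. *)
Lemma p_fun_quadratic (Ste alpha xi : R) :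
  0 < Ste -> 0 < xi ->
  let A := Rpower 2 (alpha + 1) * Rpower xi (alpha + 2) / Ste in
  p_fun Ste alpha xi
  = Ste ^ 2 *
    ((A ^ 2 / 2 * (alpha ^ 2 + alpha + 4) + (A / 2 + 1) * (2 + 3 * alpha + 3 * alpha ^ 2))
       * xi ^ 4
     - 5 * (1 + alpha) * (2 - A - A ^ 2) * xi ^ 2
     + 15 * (1 - A) ^ 2).
Proof.
  intros hSte hxi A. unfold p_fun, A.
  replace (2 * alpha + 8) with (alpha + alpha + 2 + 2 + 2 + 2) by ring.
  replace (2 * alpha + 6) with (alpha + alpha + 2 + 2 + 2) by ring.
  replace (2 * alpha + 4) with (alpha + alpha + 2 + 2) by ring.
  replace (alpha + 6) with (alpha + 2 + 2 + 2) by ring.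
  replace (alpha + 4) with (alpha + 2 + 2) by ring.
  replace (2 * alpha + 1) with (alpha + alpha + 1) by ring.
  replace (2 * alpha + 2) with (alpha + alpha + 2) by ring.
  rewrite !Rpower_plus_2, !Rpower_plus_1 by lra.
  rewrite !(Rpower_plus alpha alpha). field. lra.
Qed.

(** Here [s' / s = 1 / (2 t)] and [s ^ 2 = 4 a ^ 2 nu ^ 2 t], so [a] cancels and all six terms share
    the factor [Rpower t (alpha - 2)]. *)
Lemma ls_error_self_similar (theta alpha a Ste nu A : R) (s : R -> R) (t : R) :
  0 < a -> 0 < Ste -> 0 < nu -> 0 < t ->
  A = Rpower 2 (alpha + 1) * Rpower nu (alpha + 2) / Ste ->
  (forall u, 0 <= u -> s u = 2 * a * nu * sqrt u) ->
  ls_error theta alpha a A (1 - A) s t = reduced_error Ste theta alpha t nu.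
Proof.
  intros ha hSte hnu ht hA hs. assert (hq := sqrt_lt_R0 t ht).
  assert (hd : Derive s t = 2 * a * nu / (2 * sqrt t)).
  { apply is_derive_unique.
    apply is_derive_ext_loc with (fun u => 2 * a * nu * sqrt u).
    - generalize (open_gt 0 t ht). apply filter_imp. intros u hu.
      symmetry. apply hs. lra.
    - apply is_derive_self_similar, ht. }
  unfold ls_error, reduced_error.
  rewrite p_fun_quadratic, <- hA, hd, (hs t) by lra.
  replace (Rpower t alpha) with (Rpower t (alpha - 2) * t ^ 2)
    by (rewrite <- Rpower_plus_2 by exact ht; f_equal; lra).
  replace (Rpower t (alpha - 1)) with (Rpower t (alpha - 2) * t)
    by (rewrite <- Rpower_plus_1 by exact ht; f_equal; lra).
  (* With [t = q ^ 2] and the common power abstracted as [E], a rational identity is left. *)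
  assert (et : t = sqrt t ^ 2) by (symmetry; apply pow2_sqrt; lra).
  generalize dependent (Rpower t (alpha - 2)). intros E.
  clear hs hd. generalize dependent (sqrt t). intros q hq ->.
  field. lra.
Qed.

Theorem theorem5p1 :
  forall (k rho c gamma theta alpha : R)
         (hk : 0 < k) (hrho : 0 < rho) (hc : 0 < c) (hgamma : 0 < gamma)
         (htheta : 0 < theta) (halpha : 0 <= alpha),
  let a := diffusion_coef k rho c in
  let Ste := stefan_number k gamma theta alpha a in
  forall (T4 : R -> R -> R) (s4 : R -> R),
  P4_solution k rho c gamma theta alpha T4 s4 ->
  exists nu4 A4 B4 : R,
    0 < nu4 /\
    A4 = Rpower 2 (alpha + 1) * Rpower nu4 (alpha + 2) / Ste /\
    B4 = 1 - Rpower 2 (alpha + 1) * Rpower nu4 (alpha + 2) / Ste /\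
    (forall t, 0 <= t -> s4 t = 2 * a * nu4 * sqrt t) /\
    (forall x t, 0 < t -> 0 <= x <= s4 t ->
       T4 x t = Rpower t (alpha / 2) * theta *
                  (A4 * (1 - x / s4 t) + B4 * (1 - x / s4 t) ^ 2)) /\
    (forall t, 0 < t -> forall xi, 0 < xi ->
       reduced_error Ste theta alpha t nu4 <= reduced_error Ste theta alpha t xi).
Proof.
  intros k rho c gamma theta alpha hk hrho hc hgamma htheta halpha a Ste T4 s4
    [A [B [hadm hmin]]].
  assert (ha : 0 < a) by (apply diffusion_coef_pos; assumption).
  assert (hSte : 0 < Ste) by (apply stefan_number_pos; assumption).
  destruct (admissible_self_similar k gamma theta alpha a T4 s4 A B)
    as [nu [hnu [hA [hB hs]]]]; try assumption.
  exists nu, A, B. repeat split; try assumption.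
  - rewrite hB, hA. reflexivity.
  - exact (proj2 (proj1 hadm)).
  - intros t ht xi hxi.
    rewrite <- (ls_error_self_similar theta alpha a Ste nu A s4 t) by assumption.
    rewrite <- hB.
    rewrite <- (ls_error_self_similar theta alpha a Ste xi
      (Rpower 2 (alpha + 1) * Rpower xi (alpha + 2) / Ste)
      (fun u => 2 * a * xi * sqrt u) t) by (assumption || reflexivity).
    (* The errors do not mention the competing temperature, so it stays open here until the
       admissibility lemma fixes it. *)
    eapply hmin; [|exact ht].
    apply (self_similar_admissible k gamma theta alpha a xi); assumption.
Qed.
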